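(* Let $\mathsf{E}$ be a variety, let $\mathsf{B}$ and $\mathsf{C}$ be subcategories of $\mathsf{E}$, and let $\mathsf{A}$ be a full subcategory of $\mathsf{C}$. Let $\rho$ be a monic counital on $\mathsf{A}$, i.e. a natural transformation $\rho:\mathcal{J}\mathcal{F}\Rightarrow\mathcal{I}$ with all components monomorphisms, where $\mathcal{I}:\mathsf{A}\to\mathsf{E}$ and $\mathcal{J}:\mathsf{B}\to\mathsf{E}$ are the inclusions and $\mathcal{F}:\mathsf{A}\to\mathsf{B}$ is a functor, and let $\Delta=\mathsf{A}\rho\cdot\mathsf{A}$ be the associated cyclic $\mathsf{A}$-bicapsule, with $\mathsf{A}$-bimorphism $\mathcal{R}:\mathsf{A}\to\mathsf{E}$, $\mathcal{R}(a)=a\cdot\rho_{s(a)}$. Then there is a cyclic $\mathsf{C}$-bicapsule $\Sigma$ on $\mathsf{E}$ and unique cyclic $\mathsf{A}$-bicapsules $\Upsilon$, $\Lambda$ on $\mathsf{E}$ such that $$\Delta=\mathrm{Res}_{\mathsf{A}}^{\mathsf{C}}(\Sigma)\otimes_{\mathsf{A}}\Upsilon\qquad\text{and}\qquad \mathrm{Res}_{\mathsf{A}}^{\mathsf{C}}(\Sigma)=\Delta\otimes_{\mathsf{A}}\Lambda .$$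
   Context: A variety is the category of all algebras of a fixed (finitary) signature satisfying fixed equational laws, with all homomorphisms. A category is identified with its collection of morphisms with partial composition $fg=f\circ g$; $s(f)$, $t(f)$ are the identity morphisms of the domain and codomain of $f$, and $fg$ is defined iff $s(f)=t(g)$. $\mathbb{1}_{\mathsf{A}}$ is the collection of identities of $\mathsf{A}$. A left $\mathsf{A}$-capsule structure on a category $\mathsf{X}$ is a full left action of $\mathsf{A}$ on the morphisms of $\mathsf{X}$ (a partial function $a\cdot x$, defined iff a guard $a\lhd\in\mathbb{1}_{\mathsf{X}}$ equals $t(x)$, with every guard value attained, $s(a)\lhd=a\lhd$, $s(a)\cdot x=x$ and $(ab)\cdot x=a\cdot(b\cdot x)$ whenever the left sides are defined) with $a\cdot(xy)=(a\cdot x)y$; it has the form $a\cdot x=\mathcal{F}(a)x$ for a unique functor $\mathcal{F}:\mathsf{A}\to\mathsf{X}$. Right capsules are symmetric ($x\cdot a=x\mathcal{G}(a)$). An $\mathsf{A}$-bicapsule has commuting left and right $\mathsf{A}$-capsule structures. An $\mathsf{A}$-bimorphism $\mathcal{M}:\mathsf{A}\to\mathsf{X}$ to an $\mathsf{A}$-bicapsule ($\mathsf{A}$ acting on itself by composition) is a function on morphisms with $\mathcal{M}(abc)=a\cdot\mathcal{M}(b)\cdot c$ whenever $abc$ is defined. Natural transformations $\mu:\mathcal{G}\Rightarrow\mathcal{F}$ between functors $\mathsf{A}\to\mathsf{X}$ correspond to $\mathsf{A}$-bimorphisms via $\mathcal{M}(a)=\mathcal{F}(a)\mu_{s(a)}$,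 $\mu_e=\mathcal{M}(e)$. The cyclic $\mathsf{A}$-bicapsule determined by $\mu=\mathcal{M}(\mathbb{1}_{\mathsf{A}})$ is $\mathsf{A}\cdot\mu\cdot\mathsf{A}=\{a\cdot\mu_e\cdot a'\mid a,a'\in\mathsf{A},\ e\in\mathbb{1}_{\mathsf{A}},\ \text{the product is defined}\}$. ''On $\mathsf{E}$'' means $\mathsf{X}=\mathsf{E}$. For $\Delta$ and $\Sigma$ the left actions are regular, i.e. $a\cdot x=ax$ (composition in $\mathsf{E}$ via the inclusion); the right action for $\Delta$ is $x\cdot a=x\,\mathcal{J}\mathcal{F}(a)$. $\Sigma$ is associated with a $\mathsf{C}$-bimorphism $\mathcal{S}:\mathsf{C}\to\mathsf{E}$. $\mathrm{Res}_{\mathsf{A}}^{\mathsf{C}}(\Sigma)$ is the restriction, associated with the $\mathsf{A}$-bimorphism $a\mapsto\mathcal{S}(a)$ ($a\in\mathsf{A}\le\mathsf{C}$). In the language of bimorphisms the first tensor equation means: writing $\mathcal{T}:\mathsf{A}\to\mathsf{E}$ for the $\mathsf{A}$-bimorphism of $\Upsilon$ (whose left $\mathsf{A}$-action is the restriction to $\mathsf{A}$ of the functor giving the right action of $\Sigma$, and whose right action is that of $\Delta$), $$\mathcal{R}(a)=\mathcal{S}(t(a))\,\mathcal{T}(a)=\mathcal{S}(a)\,\mathcal{T}(s(a))\quad\text{for all }a\in\mathsf{A}.$$ The second equation means analogously, for the $\mathsf{A}$-bimorphism $\mathcal{T}'$ of $\Lambda$ (left action given by the functor of the right action of $\Delta$,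 right action the restricted right action of $\Sigma$), $\mathcal{S}(a)=\mathcal{R}(t(a))\,\mathcal{T}'(a)=\mathcal{R}(a)\,\mathcal{T}'(s(a))$ for all $a\in\mathsf{A}$. *)

(* Defs.v *)
From mathcomp Require Import all_boot.
From mathcomp Require Import boolp.

Set Implicit Arguments.
Unset Strict Implicit.
Unset Printing Implicit Defensive.

(* Categories are single-sorted: a category is its collection of morphisms
   with a partial composition.  Partial operations are given by their graphs:
   [comp f g h] reads "f g is defined and equals h", where f g = f o g.  An
   object is represented by its identity morphism. *)
Record category := Category {
  mor :> Type;
  src : mor -> mor;
  tgt : mor -> mor;
  comp : mor -> mor -> mor -> Prop;
  comp_fun : forall f g h h', comp f g h -> comp f g h' -> h = h';
  comp_def : forall f g, (exists h, comp f g h) <-> src f = tgt g;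
  src_src : forall f, src (src f) = src f;
  tgt_src : forall f, tgt (src f) = src f;
  src_tgt : forall f, src (tgt f) = tgt f;
  tgt_tgt : forall f, tgt (tgt f) = tgt f;
  comp_src : forall f, comp f (src f) f;
  comp_tgt : forall f, comp (tgt f) f f;
  src_comp : forall f g h, comp f g h -> src h = src g;
  tgt_comp : forall f g h, comp f g h -> tgt h = tgt f;
  comp_assoc : forall f g h k,
    (exists fg, comp f g fg /\ comp fg h k) <->
    (exists gh, comp g h gh /\ comp f gh k) }.

Arguments src {c} f.
Arguments tgt {c} f.
Arguments comp {c} f g h.

Definition is_id (X : category) (e : X) : Prop := src e = e.

Definition monic (X : category) (f : X) : Prop :=
  forall g h k, comp f g k -> comp f h k -> g = h.

Definition mul (X : category) (f g : X) (fg : src f = tgt g) : X :=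
  projT1 (cid (proj2 (comp_def f g) fg)).

Lemma mulP (X : category) (f g : X) (fg : src f = tgt g) : comp f g (mul fg).
Proof. exact: (projT2 (cid (proj2 (comp_def f g) fg))). Qed.

Lemma comp_defd (X : category) (f g h : X) : comp f g h -> src f = tgt g.
Proof. by move=> c; apply/comp_def; exists h. Qed.

Lemma is_id_src (X : category) (f : X) : is_id (src f).
Proof. exact: src_src. Qed.

Lemma comp_assocl (X : category) (f g h fg gh k : X) :
  comp f g fg -> comp g h gh -> comp f gh k -> comp fg h k.
Proof.
move=> c1 c2 c3.
have [fg' [c4 c5]] : exists u, comp f g u /\ comp u h k.
  by apply/comp_assoc; exists gh.
by rewrite (comp_fun c1 c4).
Qed.

Lemma comp_assocr (X : category) (f g h fg gh k : X) :
  comp f g fg -> comp g h gh -> comp fg h k -> comp f gh k.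
Proof.
move=> c1 c2 c3.
have [gh' [c4 c5]] : exists u, comp g h u /\ comp f u k.
  by apply/comp_assoc; exists fg.
by rewrite (comp_fun c2 c4).
Qed.

Record functor (A X : category) := Functor {
  fmap :> A -> X;
  fmap_src : forall a, fmap (src a) = src (fmap a);
  fmap_tgt : forall a, fmap (tgt a) = tgt (fmap a);
  fmap_comp : forall a b c, comp a b c -> comp (fmap a) (fmap b) (fmap c) }.

Definition functor_comp (A B X : category) (G : functor B X) (F : functor A B) :
  functor A X.
Proof.
exists (fun a => G (F a)).
- by move=> a; rewrite !fmap_src.
- by move=> a; rewrite !fmap_tgt.
- by move=> a b c abc; do 2 apply: fmap_comp.
Defined.

(* A natural transformation G => F.  The components are indexed by the
   identities of A; the values of [component] elsewhere are irrelevant. *)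
Record nat_trans (A X : category) (G F : functor A X) := NatTrans {
  component :> A -> X;
  component_src : forall e, is_id e -> src (component e) = G e;
  component_tgt : forall e, is_id e -> tgt (component e) = F e;
  natural : forall a m,
    comp (F a) (component (src a)) m <-> comp (component (tgt a)) (G a) m }.

Record subcategory (X : category) := Subcategory {
  in_sub :> X -> Prop;
  sub_src : forall f, in_sub f -> in_sub (src f);
  sub_tgt : forall f, in_sub f -> in_sub (tgt f);
  sub_comp : forall f g h, in_sub f -> in_sub g -> comp f g h -> in_sub h }.

Definition full (X : category) (S : subcategory X) : Prop :=
  forall f, S (src f) -> S (tgt f) -> S f.

Lemma sub_inj (X : category) (S : subcategory X) (u v : {f : X | S f}) :
  sval u = sval v -> u = v.
Proof. by case: u v => [u Su] [v Sv] /= uv; apply: eq_exist. Qed.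

Definition subcat (X : category) (S : subcategory X) : category.
Proof.
refine (@Category {f : X | S f}
  (fun f => exist S (src (sval f)) (sub_src (svalP f)))
  (fun f => exist S (tgt (sval f)) (sub_tgt (svalP f)))
  (fun f g h => comp (sval f) (sval g) (sval h)) _ _ _ _ _ _ _ _ _ _ _).
- by move=> f g h h' c c'; apply: sub_inj; apply: comp_fun c c'.
- move=> f g; split=> [[h c]|[fg]].
    by apply: sub_inj => /=; exact: comp_defd c.
  have [h c] := proj2 (comp_def _ _) fg.
  by exists (exist S h (sub_comp (svalP f) (svalP g) c)).
- by move=> f; apply: sub_inj; exact: src_src.
- by move=> f; apply: sub_inj; exact: tgt_src.
- by move=> f; apply: sub_inj; exact: src_tgt.
- by move=> f; apply: sub_inj; exact: tgt_tgt.
- by move=> f; exact: comp_src.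
- by move=> f; exact: comp_tgt.
- by move=> f g h c; apply: sub_inj; exact: src_comp c.
- by move=> f g h c; apply: sub_inj; exact: tgt_comp c.
- move=> f g h k; split=> [[u [c1 c2]]|[u [c1 c2]]].
    have [v [c3 c4]] := proj1 (comp_assoc _ _ _ _) (ex_intro _ _ (conj c1 c2)).
    by exists (exist S v (sub_comp (svalP g) (svalP h) c3)).
  have [v [c3 c4]] := proj2 (comp_assoc _ _ _ _) (ex_intro _ _ (conj c1 c2)).
  by exists (exist S v (sub_comp (svalP f) (svalP g) c3)).
Defined.

Coercion subcat : subcategory >-> category.

Definition inclusion (X : category) (S : subcategory X) : functor S X.
Proof. by exists (fun f : S => sval f). Defined.

(* [lact a x y] reads "a . x is defined and equals y"; equations between
   partial expressions are Kleene equalities, except that those in [lact_src]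
   and [lact_comp] are only required when their left side is defined. *)
Record left_capsule (A X : category) := LeftCapsule {
  lguard : A -> X;
  lact : A -> X -> X -> Prop;
  lguard_id : forall a, is_id (lguard a);
  lact_fun : forall a x y y', lact a x y -> lact a x y' -> y = y';
  lact_def : forall a x, (exists y, lact a x y) <-> lguard a = tgt x;
  lact_full : forall a, exists x, lguard a = tgt x;
  lguard_src : forall a, lguard (src a) = lguard a;
  lact_src : forall a x y, lact (src a) x y -> y = x;
  lact_comp : forall a b ab x y, comp a b ab -> lact ab x y ->
    exists z, lact b x z /\ lact a z y;
  lact_mul : forall a x y z,
    (exists xy, comp x y xy /\ lact a xy z) <->
    (exists ax, lact a x ax /\ comp ax y z) }.

(* [ract x a y] reads "x . a is defined and equals y". *)
Record right_capsule (A X : category) := RightCapsule {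
  rguard : A -> X;
  ract : X -> A -> X -> Prop;
  rguard_id : forall a, is_id (rguard a);
  ract_fun : forall x a y y', ract x a y -> ract x a y' -> y = y';
  ract_def : forall x a, (exists y, ract x a y) <-> src x = rguard a;
  ract_full : forall a, exists x, src x = rguard a;
  rguard_tgt : forall a, rguard (tgt a) = rguard a;
  ract_tgt : forall x a y, ract x (tgt a) y -> y = x;
  ract_comp : forall a b ab x y, comp a b ab -> ract x ab y ->
    exists z, ract x a z /\ ract z b y;
  ract_mul : forall a x y z,
    (exists xy, comp x y xy /\ ract xy a z) <->
    (exists ya, ract y a ya /\ comp x ya z) }.

Record bicapsule (A X : category) := Bicapsule {
  left_cap : left_capsule A X;
  right_cap : right_capsule A X;
  cap_comm : forall a x b y,
    (exists ax, lact left_cap a x ax /\ ract right_cap ax b y) <->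
    (exists xb, ract right_cap x b xb /\ lact left_cap a xb y) }.

Definition bimorphism (A X : category) (D : bicapsule A X) (M : A -> X) : Prop :=
  forall a b c ab abc, comp a b ab -> comp ab c abc ->
    exists aMb, lact (left_cap D) a (M b) aMb /\
                ract (right_cap D) aMb c (M abc).

Definition cyclic_elements (A X : category) (D : bicapsule A X) (M : A -> X) :
    X -> Prop :=
  fun x => exists a e a' y, is_id e /\
    lact (left_cap D) a (M e) y /\ ract (right_cap D) y a' x.

(* A cyclic bicapsule carries its A-bimorphism M as data; its elements are
   those of A . mu . A with mu = M(1_A). *)
Record cyclic_bicapsule (A X : category) := CyclicBicapsule {
  actions :> bicapsule A X;
  bimor : A -> X;
  elements : X -> Prop;
  bimorP : bimorphism actions bimor;
  elementsE : elements = cyclic_elements actions bimor }.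

(* The capsule structure is a . x = F(a) x, respectively x . a = x G(a). *)
Definition left_by (A X : category) (L : left_capsule A X) (F : functor A X) :
  Prop := forall a x y, lact L a x y <-> comp (F a) x y.

Definition right_by (A X : category) (R : right_capsule A X) (G : functor A X) :
  Prop := forall x a y, ract R x a y <-> comp x (G a) y.

Definition left_of (A X : category) (F : functor A X) : left_capsule A X.
Proof.
exists (fun a => src (F a)) (fun a x y => comp (F a) x y).
- by move=> a; exact: is_id_src.
- by move=> a x y y'; exact: comp_fun.
- by move=> a x; exact: comp_def.
- by move=> a; exists (src (F a)); rewrite tgt_src.
- by move=> a; rewrite fmap_src src_src.
- move=> a x y; rewrite fmap_src => c; apply: (comp_fun c).
  by have := comp_defd c; rewrite src_src => ->; exact: comp_tgt.
- move=> a b ab x y /(fmap_comp F) c cy.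
  exact: (proj1 (comp_assoc _ _ _ _) (ex_intro _ _ (conj c cy))).
- by move=> a x y z; apply: iff_sym; exact: comp_assoc.
Defined.

Definition right_of (A X : category) (G : functor A X) : right_capsule A X.
Proof.
exists (fun a => tgt (G a)) (fun x a y => comp x (G a) y).
- by move=> a; exact: src_tgt.
- by move=> x a y y'; exact: comp_fun.
- by move=> x a; exact: comp_def.
- by move=> a; exists (tgt (G a)); rewrite src_tgt.
- by move=> a; rewrite fmap_tgt tgt_tgt.
- move=> x a y; rewrite fmap_tgt => c; apply: (comp_fun c).
  by have := comp_defd c; rewrite tgt_tgt => <-; exact: comp_src.
- move=> a b ab x y /(fmap_comp G) c cy.
  exact: (proj2 (comp_assoc _ _ _ _) (ex_intro _ _ (conj c cy))).
- by move=> a x y z; exact: comp_assoc.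
Defined.

Definition bicapsule_of (A X : category) (F G : functor A X) : bicapsule A X.
Proof.
by exists (left_of F) (right_of G) => a x b y; exact: comp_assoc.
Defined.

Lemma nat_trans_composable (A X : category) (G F : functor A X)
  (mu : nat_trans G F) (a : A) : src (F a) = tgt (mu (src a)).
Proof. by rewrite component_tgt ?fmap_src //; exact: is_id_src. Qed.

(* M(a) = F(a) mu_{s(a)} *)
Definition nat_trans_bimor (A X : category) (G F : functor A X)
  (mu : nat_trans G F) : A -> X := fun a => mul (nat_trans_composable mu a).

Lemma nat_trans_bimorP (A X : category) (G F : functor A X)
  (mu : nat_trans G F) : bimorphism (bicapsule_of F G) (nat_trans_bimor mu).
Proof.
move=> a b c ab abc cab cabc /=.
have M x : comp (F x) (mu (src x)) (nat_trans_bimor mu x) by exact: mulP.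
have st : src (F a) = tgt (nat_trans_bimor mu b).
  by rewrite (tgt_comp (M b)) (comp_defd (fmap_comp F cab)).
exists (mul st); split; first exact: mulP.
have Cab : comp (F ab) (mu (src b)) (mul st).
  by apply: (comp_assocl (fmap_comp F cab) (M b)); exact: mulP.
have bc : src b = tgt c by rewrite -(src_comp cab) (comp_defd cabc).
have [m Cm] : exists m, comp (F c) (mu (src c)) m by exists (nat_trans_bimor mu c).
have /natural Cm' := Cm; rewrite -bc in Cm'.
apply: (comp_assocl Cab Cm').
apply: (comp_assocr (fmap_comp F cabc) Cm).
by rewrite -(src_comp cabc); exact: M.
Qed.

Definition cyclic_of (A X : category) (G F : functor A X) (mu : nat_trans G F) :
    cyclic_bicapsule A X :=
  @CyclicBicapsule A X (bicapsule_of F G) (nat_trans_bimor mu) _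
    (nat_trans_bimorP mu) erefl.

Section Restriction.
Variables (C X : category) (A : subcategory C).

Definition res_left (L : left_capsule C X) : left_capsule A X.
Proof.
exists (fun a : A => lguard L (sval a)) (fun (a : A) x y => lact L (sval a) x y).
- by move=> a; exact: lguard_id.
- by move=> a; exact: lact_fun.
- by move=> a; exact: lact_def.
- by move=> a; exact: lact_full.
- by move=> a; exact: lguard_src.
- by move=> a x y; exact: lact_src.
- move=> a b ab x y c.
  exact: (lact_comp (c : comp (sval a) (sval b) (sval ab))).
- by move=> a; exact: lact_mul.
Defined.

Definition res_right (R : right_capsule C X) : right_capsule A X.
Proof.
exists (fun a : A => rguard R (sval a)) (fun x (a : A) y => ract R x (sval a) y).
- by move=> a; exact: rguard_id.
- by move=> x a; exact: ract_fun.
- by move=> x a; exact: ract_def.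
- by move=> a; exact: ract_full.
- by move=> a; exact: rguard_tgt.
- by move=> x a y; exact: ract_tgt.
- move=> a b ab x y c.
  exact: (ract_comp (c : comp (sval a) (sval b) (sval ab))).
- by move=> a; exact: ract_mul.
Defined.

Definition res_bicapsule (D : bicapsule C X) : bicapsule A X.
Proof.
exists (res_left (left_cap D)) (res_right (right_cap D)) => a x b y.
exact: cap_comm.
Defined.

Lemma res_bimorP (S : cyclic_bicapsule C X) :
  bimorphism (res_bicapsule S) (fun a : A => bimor S (sval a)).
Proof.
move=> a b c ab abc abE abcE.
exact: (bimorP S (abE : comp (sval a) (sval b) (sval ab))
                 (abcE : comp (sval ab) (sval c) (sval abc))).
Qed.

Definition res (S : cyclic_bicapsule C X) : cyclic_bicapsule A X :=
  @CyclicBicapsule A X (res_bicapsule S) (fun a : A => bimor S (sval a)) _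
    (res_bimorP S) erefl.

End Restriction.

(* D = S (x)_A U for cyclic A-bicapsules on X: D has the left action of S and
   the right action of U, the inner actions of S and U are given by one functor
   G, and R(a) = S(t(a)) T(a) = S(a) T(s(a)) for the bimorphisms R, S, T of
   D, S, U. *)
Definition is_tensor (A X : category) (D S U : cyclic_bicapsule A X) : Prop :=
  [/\ forall a x y, lact (left_cap D) a x y <-> lact (left_cap S) a x y,
      forall x a y, ract (right_cap D) x a y <-> ract (right_cap U) x a y,
      exists G : functor A X, right_by (right_cap S) G /\ left_by (left_cap U) G
    & forall a, comp (bimor S (tgt a)) (bimor U a) (bimor D a) /\
                comp (bimor S a) (bimor U (src a)) (bimor D a)].

(* No nonemptiness is imposed on algebras; the variables of terms are indexed by
   nat, which suffices for finitary laws. *)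
Record signature := Signature { opsym : Type; arity : opsym -> nat }.

Inductive term (Sg : signature) :=
| Var of nat
| App (o : opsym Sg) of ('I_(arity o) -> term Sg).

Record algebra (Sg : signature) := Algebra {
  carrier :> Type;
  op : forall o : opsym Sg, ('I_(arity o) -> carrier) -> carrier }.

Fixpoint eval (Sg : signature) (X : algebra Sg) (v : nat -> X) (t : term Sg) : X :=
  match t with
  | Var n => v n
  | App o ts => op (fun i => eval v (ts i))
  end.

Record variety := Variety {
  sig : signature;
  law : term sig -> term sig -> Prop }.

Record model (V : variety) := Model {
  alg :> algebra (sig V);
  satisfies : forall s t, law s t -> forall v : nat -> alg, eval v s = eval v t }.

Record hom (V : variety) (X Y : model V) := Hom {
  hom_fun :> X -> Y;
  hom_op : forall (o : opsym (sig V)) (x : 'I_(arity o) -> X),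
    hom_fun (op x) = op (fun i => hom_fun (x i)) }.

Lemma hom_ext (V : variety) (X Y : model V) (f g : hom X Y) : f =1 g -> f = g.
Proof.
case: f g => [f fP] [g gP] /= /funext fg.
by move: fP; rewrite fg => fP; congr Hom; exact: Prop_irrelevance.
Qed.

Definition hom_id (V : variety) (X : model V) : hom X X :=
  @Hom V X X id (fun _ _ => erefl).

Definition hom_comp (V : variety) (X Y Z : model V) (f : hom Y Z) (g : hom X Y) :
  hom X Z.
Proof. by exists (f \o g) => o x /=; rewrite !hom_op. Defined.

Record arrow (V : variety) := Arrow {
  dom : model V;
  cod : model V;
  arrow_hom :> hom dom cod }.

Inductive arrow_comp (V : variety) : arrow V -> arrow V -> arrow V -> Prop :=
  ArrowComp (X Y Z : model V) (f : hom Y Z) (g : hom X Y) :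
    arrow_comp (Arrow f) (Arrow g) (Arrow (hom_comp f g)).

Lemma arrow_compP (V : variety) (X Y Z : model V) (f : hom Y Z) (g : hom X Y) h :
  arrow_comp (Arrow f) (Arrow g) h -> h = Arrow (hom_comp f g).
Proof.
pose castg (f g : arrow V) (e : cod g = dom f) : hom (dom g) (dom f) :=
  ecast Y (hom (dom g) Y) e (arrow_hom g).
have gen (u w k : arrow V) : arrow_comp u w k ->
    forall e : cod w = dom u, k = Arrow (hom_comp (arrow_hom u) (castg u w e)).
  case=> X' Y' Z' f' g' /= e.
  by rewrite (Prop_irrelevance e erefl).
by move=> /gen /(_ erefl).
Qed.

Lemma hom_compA (V : variety) (W X Y Z : model V)
  (f : hom Y Z) (g : hom X Y) (h : hom W X) :
  hom_comp (hom_comp f g) h = hom_comp f (hom_comp g h).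
Proof. exact: hom_ext. Qed.

Definition variety_category (V : variety) : category.
Proof.
refine (@Category (arrow V) (fun f => Arrow (hom_id (dom f)))
  (fun f => Arrow (hom_id (cod f))) (@arrow_comp V) _ _ _ _ _ _ _ _ _ _ _) => //.
- by move=> f g h h' c; case: c h' => X Y Z f' g' h' /arrow_compP.
- move=> f g; split=> [[h []] //|].
  case: f g => [Y Z f] [X Y' g] /(congr1 (@dom V)) /= e.
  by subst Y'; exists (Arrow (hom_comp f g)); exact: ArrowComp.
- case=> X Y f /=; rewrite (_ : Arrow f = Arrow (hom_comp f (hom_id X))) //=.
    by rewrite {1}(_ : hom_comp f (hom_id X) = f); [exact: ArrowComp|exact: hom_ext].
  by congr Arrow; exact: hom_ext.
- case=> X Y f /=; rewrite (_ : Arrow f = Arrow (hom_comp (hom_id Y) f)) //=.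
    by rewrite {1}(_ : hom_comp (hom_id Y) f = f); [exact: ArrowComp|exact: hom_ext].
  by congr Arrow; exact: hom_ext.
- by move=> f g h [].
- by move=> f g h [].
- move=> f g h k; split=> [[u [c1 c2]]|[u [c1 c2]]].
    case: c1 c2 => X Y Z f' g' c2.
    have e : dom (Arrow (hom_comp f' g')) = cod h by case: _ _ _ / c2.
    case: h e c2 => [W X' h] /= e; subst X' => /arrow_compP ->.
    by exists (Arrow (hom_comp g' h)); rewrite hom_compA; split; exact: ArrowComp.
  case: c1 c2 => X Y Z g' h' c2.
  have e : dom f = cod (Arrow (hom_comp g' h')) by case: _ _ _ / c2.
  case: f e c2 => [Z' W f] /= e; subst Z' => /arrow_compP ->.
  by exists (Arrow (hom_comp f g')); rewrite -hom_compA; split; exact: ArrowComp.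
Defined.

(* Main.v *)
(** Extend the subobjects rho_e from A to C by letting G(c) be the subalgebra of
    c generated by the images of all composites f rho_e with f : e -> c in C and
    e in A; every morphism of C restricts to these subalgebras, so the inclusions
    sigma_c : G(c) -> c form a counital on C.  If c lies in A, then fullness puts
    each such f in A, and naturality gives f rho_e = rho_c F(f); hence G(c) is the
    image of rho_c.  Monomorphisms of a variety are injective, so sigma_c and
    rho_c factor through each other, uniquely, and the two families of factors
    are the natural transformations defining Upsilon and Lambda. *)
From mathcomp Require Import all_boot.
From mathcomp Require Import boolp.
Require Import Defs.

Set Implicit Arguments.
Unset Strict Implicit.
Unset Printing Implicit Defensive.

Lemma sval_inj (T : Type) (P : T -> Prop) (u v : {x : T | P x}) :
  sval u = sval v -> u = v.
Proof. by case: u v => [u Pu] [v Pv] /= uv; exact: eq_exist. Qed.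

(** * Cancelling identities in a single-sorted category *)

Section Categories.
Variable X : category.
Implicit Types e f g h x : X.

Lemma is_id_tgt e : is_id e -> tgt e = e.
Proof. by move=> <-; rewrite tgt_src. Qed.

Lemma comp_idl e f g : is_id e -> comp e f g -> g = f.
Proof.
move=> ide c; apply: (comp_fun c).
by rewrite -ide (comp_defd c); exact: comp_tgt.
Qed.

Lemma comp_idr e f g : is_id e -> comp f e g -> g = f.
Proof.
move=> ide c; apply: (comp_fun c).
by rewrite -(is_id_tgt ide) -(comp_defd c); exact: comp_src.
Qed.

End Categories.

(** * Extensionality of capsules and cyclic bicapsules *)

Section Capsules.
Variables A X : category.

(** The action determines the guard: [lguard L a] is an identity, hence its own target, so [a] acts
    on it in [L] and therefore in [L'], which forces the guards to agree. *)
Lemma left_capsule_ext (L L' : left_capsule A X) :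
  (forall a x y, lact L a x y <-> lact L' a x y) -> L = L'.
Proof.
move=> LL'.
have guardE : lguard L = lguard L'.
  apply: funext => a.
  have tE : tgt (lguard L a) = lguard L a := is_id_tgt (lguard_id L a).
  have [y /LL' La] : exists y, lact L a (lguard L a) y by apply/lact_def.
  by rewrite -[LHS]tE; apply/esym/lact_def; exists y.
have actE : lact L = lact L'.
  by apply: funext => a; apply: funext => x; apply: funext => y; apply/propext.
case: L L' {LL'} guardE actE => [g l ? ? ? ? ? ? ? ?] [g' l' ? ? ? ? ? ? ? ?] /=.
by move=> ? ?; subst g' l'; congr LeftCapsule; exact: Prop_irrelevance.
Qed.

Lemma right_capsule_ext (R R' : right_capsule A X) :
  (forall x a y, ract R x a y <-> ract R' x a y) -> R = R'.
Proof.
move=> RR'.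
have guardE : rguard R = rguard R'.
  apply: funext => a.
  have [y /RR' Ra] : exists y, ract R (rguard R a) a y.
    by apply/ract_def; exact: rguard_id.
  by rewrite -[LHS](rguard_id R a); apply/ract_def; exists y.
have actE : ract R = ract R'.
  by apply: funext => a; apply: funext => x; apply: funext => y; apply/propext.
case: R R' {RR'} guardE actE => [g l ? ? ? ? ? ? ? ?] [g' l' ? ? ? ? ? ? ? ?] /=.
by move=> ? ?; subst g' l'; congr RightCapsule; exact: Prop_irrelevance.
Qed.

(** The element sets agree because [elementsE] computes them from the actions and the bimorphism. *)
Lemma cyclic_bicapsule_ext (D D' : cyclic_bicapsule A X) :
  (forall a x y, lact (left_cap D) a x y <-> lact (left_cap D') a x y) ->
  (forall x a y, ract (right_cap D) x a y <-> ract (right_cap D') x a y) ->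
  bimor D =1 bimor D' -> D = D'.
Proof.
case: D D' => [[L R LR] M E P EE] [[L' R' LR'] M' E' P' EE'] /=.
move=> /left_capsule_ext ? /right_capsule_ext ? /funext ?; subst L' R' M'.
have ? := Prop_irrelevance LR LR'; subst LR'.
by subst E E'; congr CyclicBicapsule; exact: Prop_irrelevance.
Qed.

(** Letting [a] act on the identity [tgt (G a)] returns both [G a] and [G' a]. *)
Lemma right_by_inj (R : right_capsule A X) (G G' : functor A X) :
  right_by R G -> right_by R G' -> G =1 G'.
Proof.
move=> RG RG' a; apply: (@comp_idl _ (tgt (G a))); first exact: src_tgt.
by apply/RG'/RG; exact: comp_tgt.
Qed.

Section Bimorphism.
Variables (D : cyclic_bicapsule A X) (F G : functor A X).
Hypotheses (DF : left_by (left_cap D) F) (DG : right_by (right_cap D) G).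

(** This is the bimorphism law for the product of [a], [src a] and [src a]; the identity [src a]
    acts trivially on the right. *)
Lemma bimor_left a : comp (F a) (bimor D (src a)) (bimor D a).
Proof.
have [y [/DF c1 /DG c2]] := bimorP D (comp_src a) (comp_src a).
by rewrite (comp_idr _ c2)// /is_id fmap_src src_src.
Qed.

Lemma bimor_right a : comp (bimor D (tgt a)) (G a) (bimor D a).
Proof.
have c : comp (tgt a) (tgt a) (tgt a) by rewrite -{1}[tgt a]tgt_tgt; exact: comp_tgt.
have [y [/DF c1 /DG c2]] := bimorP D c (comp_tgt a).
by rewrite -(comp_idl _ c1)// /is_id fmap_tgt src_tgt.
Qed.

Lemma src_bimor a : src (bimor D a) = src (G a).
Proof. exact: src_comp (bimor_right a). Qed.

End Bimorphism.

Lemma nat_trans_bimor_id (G F : functor A X) (mu : nat_trans G F) e :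
  is_id e -> nat_trans_bimor mu e = mu e.
Proof.
move=> ide; have := mulP (nat_trans_composable mu e).
by move=> /comp_idl; rewrite -/(nat_trans_bimor mu e) ide; apply;
  rewrite /is_id -fmap_src ide.
Qed.

(** * Existence and uniqueness of the right tensor factor when the left one is monic *)

Section Tensor.
Variables (D S : cyclic_bicapsule A X) (I G H : functor A X).
Hypotheses (SI : left_by (left_cap S) I) (SG : right_by (right_cap S) G).
Hypotheses (DI : left_by (left_cap D) I) (DH : right_by (right_cap D) H).
Hypothesis S_monic : forall e, is_id e -> monic (bimor S e).

(** The right action of [U] is that of [D], its left action is by the functor that the right action
    of [S] determines, and cancelling the monomorphism [bimor S (tgt a)] determines [bimor U a]. *)
Lemma is_tensor_inj (U U' : cyclic_bicapsule A X) :
  is_tensor D S U -> is_tensor D S U' -> U = U'.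
Proof.
move=> [_ DU [K [SK UK]] UE] [_ DU' [K' [SK' UK']] UE'].
apply: cyclic_bicapsule_ext => [a x y|x a y|a].
- by rewrite (UK a x y) (UK' a x y) (right_by_inj SK SK').
- by rewrite -DU -DU'.
- apply: (S_monic (e := tgt a)); first exact: src_tgt.
    exact: (proj1 (UE a)).
  exact: (proj1 (UE' a)).
Qed.

Section Factor.
Variable t : A -> X.
Hypothesis tP : forall e, is_id e -> comp (bimor S e) (t e) (bimor D e).

(** Writing S and D for the bimorphisms: S(tgt a) G(a) t(src a) = S(a) t(src a) = I(a) S(src a)
    t(src a) = I(a) D(src a) = D(a). *)
Lemma factor_left a m : comp (G a) (t (src a)) m ->
  comp (bimor S (tgt a)) m (bimor D a).
Proof.
move=> c; apply: (comp_assocr (bimor_right SI SG a) c).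
exact: (comp_assocl (bimor_left SI SG a) (tP (is_id_src a))
                    (bimor_left DI DH a)).
Qed.

Lemma factor_right a m : comp (t (tgt a)) (H a) m ->
  comp (bimor S (tgt a)) m (bimor D a).
Proof.
move=> c.
exact: (comp_assocr (tP (src_tgt a)) c (bimor_right DI DH a)).
Qed.

Lemma factor_src e : is_id e -> src (t e) = H e.
Proof.
by move=> ide; rewrite -(src_comp (tP ide)) (src_bimor DI DH) -fmap_src ide.
Qed.

Lemma factor_tgt e : is_id e -> tgt (t e) = G e.
Proof.
by move=> ide; rewrite -(comp_defd (tP ide)) (src_bimor SI SG) -fmap_src ide.
Qed.

(** Both sides of the naturality square become [bimor D a] after composition with the monomorphism
    [bimor S (tgt a)]. *)
Lemma factor_natural a m :
  comp (G a) (t (src a)) m <-> comp (t (tgt a)) (H a) m.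
Proof.
have [m1 c1] : exists m1, comp (G a) (t (src a)) m1.
  by apply/comp_def; rewrite factor_tgt ?fmap_src//; exact: is_id_src.
have [m2 c2] : exists m2, comp (t (tgt a)) (H a) m2.
  by apply/comp_def; rewrite factor_src ?fmap_tgt//; exact: src_tgt.
have m12 : m1 = m2.
  by apply: (S_monic (src_tgt a)); [exact: factor_left|exact: factor_right].
split=> c; first by rewrite (comp_fun c c1) m12.
by rewrite (comp_fun c c2) -m12.
Qed.

Definition factor_nat_trans : nat_trans H G :=
  NatTrans factor_src factor_tgt factor_natural.

Lemma factor_tensor : is_tensor D S (cyclic_of factor_nat_trans).
Proof.
split=> [a x y|x a y||a] /=.
- by rewrite (DI a x y) (SI a x y).
- exact: DH.
- by exists G; split.
split; first by apply: factor_left; exact: mulP.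
rewrite nat_trans_bimor_id; last exact: is_id_src.
exact: (comp_assocl (bimor_left SI SG a) (tP (is_id_src a))
                    (bimor_left DI DH a)).
Qed.

End Factor.

Lemma tensor_exists_unique :
  (forall e, is_id e -> exists t, comp (bimor S e) t (bimor D e)) ->
  exists! U, is_tensor D S U.
Proof.
move=> fac.
have /choice[t tP] e : exists t, is_id e -> comp (bimor S e) t (bimor D e).
  case: (pselect (is_id e)) => [/fac[t ct]|nid]; first by exists t.
  (* An arbitrary value: only the components at identities matter. *)
  by exists (bimor S e).
exists (cyclic_of (factor_nat_trans tP)); split; first exact: factor_tensor.
by move=> U; apply: is_tensor_inj; exact: factor_tensor.
Qed.

End Tensor.
End Capsules.

(** * Homomorphisms, subalgebras and monomorphisms in a variety *)

Section Varieties.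
Variable V : variety.
Implicit Types X Y Z : model V.

(** The endpoint equalities are arguments of [cast], so proof irrelevance turns them into [erefl]
    and [cast] returns the homomorphism itself. *)
Lemma Arrow_inj X Y (f g : hom X Y) : Arrow f = Arrow g -> f = g.
Proof.
pose cast (u : arrow V) (e1 : dom u = X) (e2 : cod u = Y) : hom X Y :=
  eq_rect _ (fun Z => hom Z Y) (eq_rect _ (hom (dom u)) (arrow_hom u) _ e2) _ e1.
have gen u : u = Arrow f -> forall e1 e2, cast u e1 e2 = f.
  by move=> -> e1 e2; rewrite (Prop_irrelevance e1 erefl) (Prop_irrelevance e2 erefl).
by move=> fg; rewrite -(gen (Arrow g) (esym fg) erefl erefl).
Qed.

Lemma arrow_comp_factor X Y Z (f : hom Y Z) (h : hom X Z) (k : arrow V) :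
  arrow_comp (Arrow f) k (Arrow h) -> exists g : hom X Y, h =1 f \o g.
Proof.
move=> c.
have ek : cod k = Y.
  by have := @comp_defd (variety_category V) _ _ _ c => /(congr1 (@dom V)) /= ->.
have dk : dom k = X.
  by have := @src_comp (variety_category V) _ _ _ c => /(congr1 (@dom V)) /= ->.
case: k ek dk c => [X' Y' g] /= ? ?; subst X' Y' => /arrow_compP/Arrow_inj ->.
by exists g.
Qed.

Lemma eval_morph (Sg : signature) (X Y : algebra Sg) (g : X -> Y) :
  (forall o (x : 'I_(arity o) -> X), g (op x) = op (fun i => g (x i))) ->
  forall v t, g (eval v t) = eval (g \o v) t.
Proof.
move=> gop v; elim=> [n|o ts IH] //=; rewrite gop; congr op.
by apply: funext => i; exact: IH.
Qed.

Definition op_closed X (P : X -> Prop) : Prop :=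
  forall (o : opsym (sig V)) (x : 'I_(arity o) -> X),
    (forall i, P (x i)) -> P (op x).

Section Subalgebra.
Variables (X : model V) (P : X -> Prop) (P_op : op_closed P).

Definition sub_algebra : algebra (sig V) :=
  @Algebra (sig V) {x : X | P x} (fun o x =>
    exist P (op (fun i => sval (x i))) (P_op (fun i => svalP (x i)))).

Definition sub_model : model V.
Proof.
exists sub_algebra => s t st v; apply: sval_inj.
by rewrite !(@eval_morph _ sub_algebra X sval)//; exact: satisfies.
Defined.

Definition sub_incl : hom sub_model X :=
  @Hom V sub_model X sval (fun _ _ => erefl).

Lemma sub_incl_inj : injective sub_incl.
Proof. by move=> u v; exact: sval_inj. Qed.

End Subalgebra.

Section KernelPair.
Variables (X Y : model V) (f : hom X Y).

Definition kernel_pair_algebra : algebra (sig V).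
Proof.
exists {p : X * X | f p.1 = f p.2} => o x.
exists (op (fun i => (sval (x i)).1), op (fun i => (sval (x i)).2)) => /=.
by rewrite !hom_op; congr op; apply: funext => i; exact: svalP (x i).
Defined.

Definition kernel_pair : model V.
Proof.
exists kernel_pair_algebra => s t st v; apply: sval_inj.
rewrite [LHS]surjective_pairing [RHS]surjective_pairing.
rewrite !(@eval_morph _ kernel_pair_algebra X (fun p => (sval p).1))//.
rewrite !(@eval_morph _ kernel_pair_algebra X (fun p => (sval p).2))//.
by congr pair; exact: satisfies.
Defined.

Definition kernel_pair_fst : hom kernel_pair X :=
  @Hom V kernel_pair X (fun p => (sval p).1) (fun _ _ => erefl).

Definition kernel_pair_snd : hom kernel_pair X :=
  @Hom V kernel_pair X (fun p => (sval p).2) (fun _ _ => erefl).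

(** The two projections of the kernel pair have the same composite with [f], hence coincide; they
    are then evaluated at the pair [(x, y)]. *)
Lemma monic_inj : @monic (variety_category V) (Arrow f) -> injective f.
Proof.
move=> fm x y fxy.
have c1 : arrow_comp (Arrow f) (Arrow kernel_pair_fst)
    (Arrow (hom_comp f kernel_pair_fst)) by exact: ArrowComp.
have c2 : arrow_comp (Arrow f) (Arrow kernel_pair_snd)
    (Arrow (hom_comp f kernel_pair_fst)).
  rewrite (_ : hom_comp f kernel_pair_fst = hom_comp f kernel_pair_snd).
    exact: ArrowComp.
  by apply: hom_ext => p; exact: svalP p.
have /Arrow_inj pq := fm _ _ _ c1 c2.
exact: (congr1 (fun g : hom kernel_pair X => g (exist _ (x, y) fxy)) pq).
Qed.

End KernelPair.

Lemma inj_monic X Y (f : hom X Y) :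
  injective f -> @monic (variety_category V) (Arrow f).
Proof.
move=> f_inj g h k cg ch.
have eg : cod g = X := esym (congr1 (@dom V) (comp_defd cg)).
have eh : cod h = X := esym (congr1 (@dom V) (comp_defd ch)).
have dgh : dom g = dom h.
  exact: (congr1 (@dom V) (etrans (esym (src_comp cg)) (src_comp ch))).
case: g eg dgh cg => [Z X' g] /= ?; subst X'.
case: h eh ch => [Z' X' h] /= ?; subst X' => ch ? cg; subst Z'.
congr Arrow; apply: hom_ext => z; apply: f_inj.
move: cg ch => /arrow_compP -> /arrow_compP/Arrow_inj.
by move=> /(congr1 (fun q : hom Z Y => q z)).
Qed.

(** Preimages under [f] are unique, so choosing them pointwise gives a map that respects the
    operations. *)
Lemma factor_through_inj X Y Z (f : hom Y Z) (g : hom X Z) :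
  injective f -> (forall x, exists y, f y = g x) ->
  exists t, arrow_comp (Arrow f) t (Arrow g).
Proof.
move=> f_inj /choice[t ft].
have t_op o (x : 'I_(arity o) -> X) : t (op x) = op (fun i => t (x i)).
  apply: f_inj; rewrite ft !hom_op; congr op.
  by apply: funext => i; rewrite ft.
exists (Arrow (Hom t_op)).
rewrite (_ : g = hom_comp f (Hom t_op)); first exact: ArrowComp.
by apply: hom_ext => x; rewrite /= ft.
Qed.

(** * Counitals from families of subalgebras stable under a subcategory *)

Section StableSubalgebras.
Variable C : subcategory (variety_category V).
Variable P : forall X, X -> Prop.
Hypothesis P_op : forall X, op_closed (@P X).
Hypothesis P_stable : forall f : C, forall x, P x -> P (arrow_hom (sval f) x).

Definition restrict_hom (f : C) :
  hom (sub_model (P_op (X := dom (sval f)))) (sub_model (P_op (X := cod (sval f)))).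
Proof.
exists (fun u => exist _ (arrow_hom (sval f) (sval u)) (@P_stable f _ (svalP u))).
by move=> o x; apply: sval_inj; exact: hom_op.
Defined.

Definition restrict : functor C (variety_category V).
Proof.
exists (fun f : C => Arrow (restrict_hom f)).
- by move=> f /=; congr Arrow; apply: hom_ext => u; exact: sval_inj.
- by move=> f /=; congr Arrow; apply: hom_ext => u; exact: sval_inj.
- move=> [f Cf] [g Cg] [h Ch] /= c; case: f g h / c Cf Cg Ch => X Y Z f g Cf Cg Ch.
  set hf := restrict_hom (exist _ (Arrow f) Cf).
  set hg := restrict_hom (exist _ (Arrow g) Cg).
  rewrite (_ : restrict_hom (exist _ _ Ch) = hom_comp hf hg); first exact: ArrowComp.
  by apply: hom_ext => u; exact: sval_inj.
Defined.

Definition restrict_incl : nat_trans restrict (inclusion C).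
Proof.
exists (fun e : C => Arrow (sub_incl (P_op (X := dom (sval e))))).
- by move=> e <- /=; congr Arrow; apply: hom_ext => u; exact: sval_inj.
- by move=> e /(congr1 sval) /= ->.
- move=> [[X Y f] Cf] m /=.
  set k := restrict_hom _.
  have kE : hom_comp f (sub_incl (P_op (X := X))) =
            hom_comp (sub_incl (P_op (X := Y))) k by exact: hom_ext.
  split=> /arrow_compP ->; last by rewrite -kE; exact: ArrowComp.
  by rewrite kE; exact: ArrowComp.
Defined.

End StableSubalgebras.

(** * Subalgebras generated by the images of the composites of [f] with [rho e] *)

Section Core.
Variables (B C : subcategory (variety_category V)) (A : subcategory C).
Variable F : functor A B.
Variable rho : nat_trans (functor_comp (inclusion B) F)
                         (functor_comp (inclusion C) (inclusion A)).

(* Indexing over all models avoids casts between [cod h] and a given model. *)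
Inductive core : forall X, X -> Prop :=
| core_gen (e : A) (f : C) (h : arrow V) (z : dom h) :
    is_id e -> arrow_comp (sval f) (rho e) h -> core (arrow_hom h z)
| core_op_closed X : op_closed (@core X).

Lemma core_stable (f : C) x : core x -> core (arrow_hom (sval f) x).
Proof.
(* Quantifying over all arrows [k] out of [X] makes induction on [core y] possible. A value of [g]
   after [rho e] goes to a value of [kg] after [rho e], and [kg] is again in [C]. *)
have gen X (y : X) : core y -> forall Y (k : hom X Y), C (Arrow k) -> core (k y).
  elim=> {X y} [e g h z ide c|X o y _ IH] Y k Ck; last first.
    by rewrite hom_op; apply: core_op_closed => i; exact: IH.
  case: h z c k Ck => [Z X h] /= z c k Ck.
  have ckh : arrow_comp (Arrow k) (Arrow h) (Arrow (hom_comp k h)) by exact: ArrowComp.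
  have [kg [ckg c']] := proj2 (@comp_assoc (variety_category V) _ _ _ _)
    (ex_intro _ _ (conj c ckh)).
  have Ckg : C kg := @sub_comp (variety_category V) C _ _ _ Ck (svalP g) ckg.
  exact: (@core_gen e (exist _ kg Ckg) (Arrow (hom_comp k h)) z ide c').
case: f x => [[X Y f] Cf] /= x cx; exact: gen cx _ _ Cf.
Qed.

(** The identity [sval e] serves as the morphism [f] of [core_gen]. *)
Lemma image_core (e : A) : is_id e -> forall X Y (r : hom X Y) x,
  rho e = Arrow r -> core (r x).
Proof.
move=> ide X Y r x re; apply: (@core_gen e (sval e) (Arrow r) x ide).
rewrite -re.
have := @comp_tgt (variety_category V) (rho e).
by rewrite (component_tgt rho ide).
Qed.

Hypothesis A_full : full A.

(** The image of a homomorphism is closed under the operations, so the generators decide. The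
    equation [rho e = Arrow r] makes the codomain of [rho e] literally [Y]. *)
Lemma core_image Y (y : Y) : core y ->
  forall e : A, is_id e -> forall X (r : hom X Y), rho e = Arrow r ->
  exists x, r x = y.
Proof.
elim=> {Y y} [e' f h z ide' c|Y o y _ IH] e ide X r re; last first.
  have /choice[x rx] i := IH i e ide X r re.
  by exists (op x); rewrite hom_op; congr op; exact: funext.
have srcf : src f = sval e'.
  apply: sub_inj.
  exact: etrans (@comp_defd (variety_category V) _ _ _ c) (component_tgt rho ide').
have tgtf : tgt f = sval e.
  apply: sub_inj; apply: etrans (component_tgt rho ide); rewrite re.
  exact: esym (@tgt_comp (variety_category V) _ _ _ c).
(* Both ends of [f] lie in [A], so fullness applies. *)
have Af : A f by apply: A_full; rewrite ?srcf ?tgtf; exact: svalP.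
pose a : A := exist _ f Af.
have sa : src a = e' by exact: sub_inj.
have ta : tgt a = e by exact: sub_inj.
(* Naturality at [a] rewrites [f] after [rho e'] as [rho e] after [F a], so [h] factors through
   [r]. *)
have := proj1 (natural rho a h).
rewrite sa ta re => /(_ c); case: h z {c tgtf} r re => [Z W h] /= z r re.
by move=> /arrow_comp_factor[g hg]; exists (g z); rewrite hg.
Qed.

End Core.
End Varieties.

Theorem theorem5p4 (V : variety)
  (B C : subcategory (variety_category V))
  (A : subcategory C) (A_full : full A)
  (F : functor A B)
  (rho : nat_trans (functor_comp (inclusion B) F)
                   (functor_comp (inclusion C) (inclusion A)))
  (rho_monic : forall e : A, is_id e -> monic (rho e)) :
  exists Sigma : cyclic_bicapsule C (variety_category V),
    left_by (left_cap Sigma) (inclusion C) /\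
    (exists! Upsilon : cyclic_bicapsule A (variety_category V),
      is_tensor (cyclic_of rho) (res A Sigma) Upsilon) /\
    (exists! Lambda : cyclic_bicapsule A (variety_category V),
      is_tensor (res A Sigma) (cyclic_of rho) Lambda).
Proof.
pose core_op := @core_op_closed V B C A F rho.
pose sigma := restrict_incl core_op (@core_stable V B C A F rho).
exists (cyclic_of sigma); split; first by [].
have sigmaE (e : A) : is_id e ->
    bimor (res A (cyclic_of sigma)) e = sigma (sval e).
  by move=> /(congr1 sval) ide; exact: nat_trans_bimor_id.
(* The cast is done once here, so that [rho e] and the inclusion [sigma (sval e)] have literally the
   same codomain. *)
have rhoE (e : A) : is_id e -> exists X (r : hom X (dom (sval (sval e)))),
    rho e = Arrow r.
  move=> ide.
  have ce : cod (rho e) = dom (sval (sval e)).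
    exact: (congr1 (@dom V) (component_tgt rho ide)).
  by case: (rho e) ce => [X Y r] /= ?; subst Y; exists X, r.
pose I := functor_comp (inclusion C) (inclusion A).
split.
(* The left factor is [sigma], monic as an inclusion; [rho e] factors through it because its values
   lie in the core. *)
- apply: (@tensor_exists_unique _ _ _ _ I
    (functor_comp (restrict core_op (@core_stable V B C A F rho)) (inclusion A))
    (functor_comp (inclusion B) F)) => //.
  + by move=> e ide; rewrite sigmaE//; apply: inj_monic; exact: sub_incl_inj.
  + move=> e ide; rewrite sigmaE// [bimor _ e]nat_trans_bimor_id//.
    have [X [r re]] := rhoE e ide; rewrite re.
    apply: factor_through_inj => [|x]; first exact: sub_incl_inj.
    by exists (exist _ (r x) (image_core ide x re)).
(* The roles are exchanged: the left factor is [rho], injective by [monic_inj], and [core_image]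
   lifts each element of the core along it. *)
- apply: (@tensor_exists_unique _ _ _ _ I (functor_comp (inclusion B) F)
    (functor_comp (restrict core_op (@core_stable V B C A F rho)) (inclusion A))) => //.
  + by move=> e ide; rewrite [bimor _ e]nat_trans_bimor_id//; exact: rho_monic.
  + move=> e ide; rewrite sigmaE// [bimor _ e]nat_trans_bimor_id//.
    have := rho_monic e ide.
    have [X [r re]] := rhoE e ide; rewrite re => /monic_inj r_inj.
    apply: factor_through_inj => // u.
    exact: (core_image A_full (svalP u) ide re).
Qed.
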